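(* Let $A \in \mathbb{R}^{n\times n}$ be a nonsingular symmetric indefinite matrix, let $b, x^{(0)} \in \mathbb{R}^n$, and let $T = |A|^{-1}$. Then the preconditioned minimal residual method with preconditioner $T$, applied to $Ax=b$ with initial guess $x^{(0)}$, converges to the solution of $Ax=b$ in at most two steps; that is, there is $i \le 2$ such that the $i$-th iterate satisfies $x^{(i)} = A^{-1}b$.
   Context: A symmetric matrix is indefinite if it has both positive and negative eigenvalues. For a real symmetric matrix $A$ with eigenvalue decomposition $A = V\Lambda V^*$ ($V$ orthogonal, $\Lambda$ diagonal), the matrix absolute value is $|A| = V|\Lambda|V^*$, where $|\Lambda|$ is the diagonal matrix of absolute values of the eigenvalues. Preconditioned minimal residual method: given a symmetric positive definite $T$ and an initial guess $x^{(0)}$ with residual $r^{(0)} = b - Ax^{(0)}$, the $i$-th iterate (in exact arithmetic) is the vector $$x^{(i)} \in x^{(0)} + \mathcal{K}_i(TA, Tr^{(0)}), \qquad \mathcal{K}_i(TA,Tr^{(0)}) = \mathrm{span}\{Tr^{(0)}, (TA)Tr^{(0)}, \ldots, (TA)^{i-1}Tr^{(0)}\},$$ whose residual $r^{(i)} = b - Ax^{(i)}$ satisfies $$\|r^{(i)}\|_T = \min_{u \in A\mathcal{K}_i(TA,Tr^{(0)})} \|r^{(0)} - u\|_T,$$ where $\|v\|_T^2 = (v, Tv)$ with $(\cdot,\cdot)$ the Euclidean inner product. By convention $\mathcal{K}_0 = \{0\}$. *)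

(* Defs.v *)
From HB Require Import structures.
From mathcomp Require Import all_boot all_order all_algebra.
From mathcomp Require Import sesquilinear.
From mathcomp Require Import boolp classical_sets reals.

Set Implicit Arguments.
Unset Strict Implicit.
Unset Printing Implicit Defensive.

Import Order.TTheory GRing.Theory Num.Theory.
Local Open Scope classical_set_scope.
Local Open Scope ring_scope.

Definition indefinitemx (R : realType) (n : nat) (A : 'M[R]_n) : Prop :=
  A \is symmetricmx /\
  (exists2 a : R, eigenvalue A a & 0 < a) /\
  (exists2 a : R, eigenvalue A a & a < 0).

Definition eigen_decomposition (R : realType) (n : nat)
    (A V : 'M[R]_n) (d : 'rV[R]_n) : Prop :=
  V^T *m V = 1%:M /\ A = V *m diag_mx d *m V^T.

(* Every real symmetric A has an eigenvalue decomposition, and V |Lambda| V^T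
   does not depend on the one chosen; the default 0 is reached only when A is
   not symmetric. *)
Definition absmx (R : realType) (n : nat) (A : 'M[R]_n) : 'M[R]_n :=
  xget 0 [set B | exists V d, eigen_decomposition A V d /\
                    B = V *m diag_mx (map_mx Num.norm d) *m V^T].

Definition dotv (R : realType) (n : nat) (u v : 'cV[R]_n) : R :=
  (u^T *m v) 0 0.

Definition spdmx (R : realType) (n : nat) (T : 'M[R]_n) : Prop :=
  T \is symmetricmx /\ forall v : 'cV[R]_n, v != 0 -> 0 < dotv v (T *m v).

Definition normT (R : realType) (n : nat) (T : 'M[R]_n) (v : 'cV[R]_n) : R :=
  Num.sqrt (dotv v (T *m v)).

Definition krylov (R : realType) (n : nat) (i : nat)
    (M : 'M[R]_n) (v : 'cV[R]_n) : {vspace 'cV[R]_n} :=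
  <<[seq (M ^+ k) *m v | k <- iota 0 i]>>%VS.

Definition is_min (R : realType) (E : set R) (m : R) : Prop :=
  E m /\ lbound E m.

(* x is an i-th iterate of the preconditioned minimal residual method for
   A x = b; positive definiteness of the preconditioner T is part of what it
   means for the method to be applicable. *)
Definition minres_iterate (R : realType) (n : nat) (A T : 'M[R]_n)
    (b x0 : 'cV[R]_n) (i : nat) (x : 'cV[R]_n) : Prop :=
  let r0 := b - A *m x0 in
  let K := krylov i (T *m A) (T *m r0) in
  let AK := (linfun (mulmx A : 'cV[R]_n -> 'cV[R]_n) @: K)%VS in
  [/\ spdmx T,
      x - x0 \in K &
      is_min [set normT T (r0 - u) | u in [set u | u \in AK]]
             (normT T (b - A *m x))].

(* Main.v *)
(** Diagonalizing A = V diag(d) V^T gives TA = V diag(sgn d) V^T, so (TA)^2 = 1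
and A^-1 = TAT. Hence the initial error A^-1 r0 = (TA)(T r0) already lies in the
second Krylov space, where the minimal residual is 0. As T is positive definite,
a zero residual norm forces the iterate to be the exact solution.

The real spectral theorem is obtained by deflation: the complex one supplies a
real eigenvalue, and a Householder reflection sends a unit eigenvector to the
first basis vector. *)
Require Import Defs.
From mathcomp Require Import all_boot all_order all_algebra.
From mathcomp Require Import reals.
From mathcomp Require Import classical_sets complex ring.

Set Implicit Arguments.
Unset Strict Implicit.
Unset Printing Implicit Defensive.

Import Order.TTheory GRing.Theory Num.Theory.
Local Open Scope ring_scope.

(** * The real spectral theorem *)

Lemma symmetricmxP (R : fieldType) (n : nat) (A : 'M[R]_n) :
  reflect (A^T = A) (A \is symmetricmx).
Proof.
rewrite qualifE/= expr0 scale1r; have -> : map_mx idfun A^T = A^T.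
  by apply/matrixP => i j; rewrite !mxE.
by rewrite eq_sym; apply: eqP.
Qed.

(** Over the complex extension of [R], [A] is Hermitian, so its spectral diagonal is real. Entry 0
    of that diagonal is a root of a characteristic polynomial with coefficients in [R], so it is
    already an eigenvalue over [R]. *)
Lemma symmetric_eigenvalue (R : rcfType) (n : nat) (A : 'M[R]_n.+1) :
  A^T = A -> exists a : R, eigenvalue A a.
Proof.
move=> AT; pose AC := map_mx (real_complex R) A.
have AC_herm : AC \is hermsymmx.
  apply: realsym_hermsym; first by apply/symmetricmxP; rewrite map_trmx AT.
  by apply/mxOverP => i j; rewrite mxE complex_real.
have /orthomx_spectralP AC_eq := hermitian_normalmx AC_herm.
have /mxOverP/(_ 0 0)/complex_realP [a da] := hermitian_spectral_diag_real AC_herm.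
exists a; rewrite eigenvalue_root_char -(fmorph_root (real_complex R)).
rewrite map_char_poly -eigenvalue_root_char; apply/eigenvalueP.
(* From AC = P^-1 D P follows P AC = D P, so the rows of P are left eigenvectors. *)
exists (row 0 (spectralmx AC)).
  rewrite -/AC [X in _ *m X]AC_eq !mulmxA -row_mul mulmxV ?spectral_unit//.
  rewrite -[X in X *m _]row_mul mul1mx row_diag_mx -scalemxAl -rowE.
  by congr (_ *: _).
apply/negP => /eqP row0.
have /(congr1 (row 0)) := mulmxV (spectral_unit AC).
rewrite row_mul row0 mul0mx.
by move/rowP/(_ 0); rewrite !mxE eqxx => /esym/eqP; rewrite oner_eq0.
Qed.

Lemma rV_sqnorm_gt0 (R : realDomainType) (n : nat) (v : 'rV[R]_n) :
  v != 0 -> 0 < (v *m v^T) 0 0.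
Proof.
move=> v0; rewrite lt_neqAle eq_sym; apply/andP; split; last first.
  by rewrite mxE sumr_ge0// => i _; rewrite mxE -expr2 sqr_ge0.
apply: contra v0; rewrite mxE psumr_eq0 => [/allP vi0|i _]; last first.
  by rewrite mxE -expr2 sqr_ge0.
apply/eqP/rowP => i; have := vi0 i (mem_index_enum _).
by rewrite !mxE mulf_eq0 orbb => /eqP.
Qed.

(* The Householder reflection in the hyperplane orthogonal to [u - v]. *)
Lemma householder (R : realFieldType) (n : nat) (u v : 'rV[R]_n) :
  u *m u^T = 1%:M -> v *m v^T = 1%:M ->
  exists H : 'M[R]_n, [/\ H^T = H, H *m H = 1%:M & u *m H = v].
Proof.
move=> uu vv; have [->|uv] := eqVneq u v.
  by exists 1%:M; rewrite trmx1 !mulmx1.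
pose w := u - v; pose q := (w *m w^T) 0 0; pose c := (u *m v^T) 0 0.
have q0 : q != 0 by rewrite gt_eqF// rV_sqnorm_gt0// subr_eq0.
have wwE : w *m w^T = q%:M by rewrite [LHS]mx11_scalar.
have uvE : u *m v^T = c%:M by rewrite [LHS]mx11_scalar.
have vuE : v *m u^T = c%:M by rewrite -[LHS]trmxK trmx_mul trmxK uvE tr_scalar_mx.
have uwE : u *m w^T = (1 - c)%:M.
  by rewrite /w linearB/= mulmxBr uu uvE -raddfB.
(* This holds because u and v are unit vectors; it makes the reflection subtract exactly w from u,
   which leaves v. *)
have qE : q = 2 * (1 - c).
  rewrite /q /w linearB/= mulmxBl !mulmxBr uu vv uvE vuE !mxE eqxx !mulr1n.
  by ring.
exists (1%:M - (2 / q) *: (w^T *m w)); split.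
- by rewrite linearB/= trmx1 linearZ/= trmx_mul trmxK.
- rewrite mulmxBr mulmx1 mulmxBl mul1mx -scalemxAl -scalemxAr.
  rewrite mulmxA -(mulmxA w^T) wwE mul_mx_scalar -scalemxAl !scalerA.
  rewrite -addrA -opprD -scalerBl -scalerDl.
  rewrite [X in X *: _](_ : _ = 0) ?scale0r ?subr0//.
  by field.
- rewrite mulmxBr mulmx1 -scalemxAr mulmxA uwE mul_scalar_mx scalerA.
  have -> : 2 / q * (1 - c) = 1 by rewrite mulrAC -qE divff.
  by rewrite scale1r /w opprB addrC subrK.
Qed.

Lemma symmetric_spectral (R : rcfType) (n : nat) (A : 'M[R]_n) :
  A^T = A ->
  exists (V : 'M[R]_n) (d : 'rV[R]_n), V^T *m V = 1%:M /\ A = V *m diag_mx d *m V^T.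
Proof.
elim: n A => [|n IHn] A AT.
  by exists 1%:M, 0; split; apply/matrixP => -[] [].
have [a /eigenvalueP [v0 v0A v0_neq0]] := symmetric_eigenvalue AT.
pose v := (Num.sqrt ((v0 *m v0^T) 0 0))^-1 *: v0.
have vA : v *m A = a *: v by rewrite -scalemxAl v0A scalerA mulrC -scalerA.
have vv : v *m v^T = 1%:M.
  have := rV_sqnorm_gt0 v0_neq0; rewrite /v; set q := (v0 *m v0^T) 0 0 => q_gt0.
  have qE : v0 *m v0^T = q%:M by rewrite [LHS]mx11_scalar.
  rewrite linearZ/= -scalemxAl -scalemxAr scalerA qE scale_scalar_mx.
  by rewrite -invfM -expr2 sqr_sqrtr ?ltW// mulVf ?gt_eqF.
pose e : 'rV[R]_(1 + n) := row_mx 1%:M 0.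
have ee : e *m e^T = 1%:M by rewrite tr_row_mx mul_row_col trmx1 mulmx1 mul0mx addr0.
have [H [HT HH vH]] := householder vv ee.
have eH : e *m H = v by rewrite -vH -mulmxA HH mulmx1.
(* [H] exchanges [v] and [e], so [e] is a left eigenvector of [B]. Hence the first row of [B] is (a,
   0), symmetry clears the first column, and induction applies to the remaining block. *)
pose B : 'M[R]_(1 + n) := H *m A *m H.
have BT : B^T = B by rewrite /B !trmx_mul HT AT mulmxA.
have eB : e *m B = a *: e by rewrite /B !mulmxA eH vA -scalemxAl vH.
have AE : A = H *m B *m H.
  by rewrite /B !mulmxA HH mul1mx -mulmxA HH mulmx1.
have usB : usubmx B = a *: e.
  by rewrite -eB -[in RHS](vsubmxK B) /e mul_row_col mul1mx mul0mx addr0.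
have ulB : ulsubmx B = a%:M.
  by rewrite /ulsubmx usB linearZ/= row_mxKl scale_scalar_mx mulr1.
have urB : ursubmx B = 0.
  by rewrite /ursubmx usB linearZ/= row_mxKr scaler0.
have dlB : dlsubmx B = 0 by rewrite -BT -trmx_ursub urB trmx0.
have drB : (drsubmx B)^T = drsubmx B by rewrite trmx_drsub BT.
have [V [d [VV BE]]] := IHn _ drB.
pose W : 'M[R]_(1 + n) := block_mx 1%:M 0 0 V.
pose D : 'rV[R]_(1 + n) := row_mx a%:M d.
have WW : W^T *m W = 1%:M.
  rewrite tr_block_mx mulmx_block.
  rewrite !trmx0 trmx1 !mulmx0 !mul0mx !addr0 add0r mulmx1 VV.
  by rewrite -scalar_mx_block.
have WDW : B = W *m diag_mx D *m W^T.
  rewrite -[LHS]submxK ulB urB dlB BE diag_mx_row tr_block_mx !mulmx_block.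
  rewrite !trmx0 trmx1 !mulmx0 !mul0mx !addr0 !add0r !mulmx1 !mul1mx.
  congr block_mx; rewrite ?mul0mx ?mulmx0//.
  by apply/matrixP => i j; rewrite !ord1 !mxE eqxx.
exists (H *m W), D; split.
  by rewrite trmx_mul HT mulmxA -(mulmxA W^T) HH mulmx1.
by rewrite trmx_mul HT AE WDW !mulmxA.
Qed.

(** * The absolute value and its inverse *)

Lemma eigen_decompositionM (R : pzRingType) (n : nat) (V : 'M[R]_n)
    (d e : 'rV[R]_n) :
  V^T *m V = 1%:M ->
  (V *m diag_mx d *m V^T) *m (V *m diag_mx e *m V^T) =
  V *m diag_mx (\row_j (d 0 j * e 0 j)) *m V^T.
Proof.
move=> VV; rewrite !mulmxA -(mulmxA _ V^T) VV mulmx1 -(mulmxA V).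
by rewrite mulmx_diag.
Qed.

Lemma eigen_decomposition_neq0 (R : realType) (n : nat) (A V : 'M[R]_n)
    (d : 'rV[R]_n) :
  eigen_decomposition A V d -> A \in unitmx -> forall j, d 0 j != 0.
Proof.
move=> [_ ->]; rewrite unitmxE unitfE !det_mulmx det_diag !mulf_eq0 !negb_or.
by case/andP => /andP [_] /prodf_neq0 d0 _ j; apply: d0.
Qed.

(** The spectral theorem makes the set under [xget] nonempty, which rules out the default 0; the
    chosen value then carries its own decomposition. *)
Lemma absmxE (R : realType) (n : nat) (A : 'M[R]_n) :
  A \is symmetricmx ->
  exists V d, eigen_decomposition A V d /\
    absmx A = V *m diag_mx (map_mx Num.norm d) *m V^T.
Proof.
move=> /symmetricmxP /symmetric_spectral [V [d VdA]].
rewrite /absmx; case: xgetP => [B _ //|].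
move/(_ (V *m diag_mx (map_mx Num.norm d) *m V^T)).
by case; exists V, d.
Qed.

(** Sharing [V] and [d] between the two matrices lets their products be computed entrywise on the
    diagonals. *)
Lemma invmx_absmxE (R : realType) (n : nat) (A : 'M[R]_n) :
  A \in unitmx -> A \is symmetricmx ->
  exists V d, [/\ eigen_decomposition A V d, forall j, d 0 j != 0 &
    invmx (absmx A) = V *m diag_mx (\row_j `|d 0 j|^-1) *m V^T].
Proof.
move=> Au /absmxE [V [d [VdA ->]]]; exists V, d.
have d0 := eigen_decomposition_neq0 VdA Au; split => //.
have [VV _] := VdA; set B := _ *m V^T; set C := _ *m V^T.
have BC : B *m C = 1%:M.
  rewrite /B /C eigen_decompositionM// (_ : \row_j _ = const_mx 1).
    by rewrite diag_const_mx mulmx1 (mulmx1C VV).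
  by apply/rowP => j; rewrite !mxE divff// normr_eq0.
have [Bu _] := mulmx1_unit BC.
by rewrite -[RHS]mul1mx -(mulVmx Bu) -mulmxA BC mulmx1.
Qed.

Lemma spdmx_diag (R : realType) (n : nat) (V : 'M[R]_n) (d : 'rV[R]_n) :
  V^T *m V = 1%:M -> (forall j, 0 < d 0 j) -> spdmx (V *m diag_mx d *m V^T).
Proof.
move=> VV d_gt0; split.
  by apply/symmetricmxP; rewrite !trmx_mul trmxK tr_diag_mx mulmxA.
(* In the coordinates [u] the quadratic form is a sum of squares with positive weights. *)
move=> v v0; pose u := V^T *m v.
have u0 : u != 0.
  apply: contra v0 => /eqP uE.
  by rewrite -[v]mul1mx -(mulmx1C VV) -mulmxA -/u uE mulmx0.
have -> : dotv v (V *m diag_mx d *m V^T *m v) = \sum_j d 0 j * u j 0 ^+ 2.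
  rewrite /dotv !mulmxA -(mulmxA _ V^T) -/u.
  have -> : v^T *m V = u^T by rewrite trmx_mul trmxK.
  rewrite mxE; apply: eq_bigr => j _.
  by rewrite mul_mx_diag !mxE mulrAC mulrC expr2.
have ge0 j : true -> 0 <= d 0 j * u j 0 ^+ 2.
  by move=> _; rewrite mulr_ge0 ?sqr_ge0 ?ltW.
rewrite lt_neqAle sumr_ge0// andbT eq_sym psumr_eq0//.
apply: contra u0 => /allP ud0; apply/eqP/colP => j.
have := ud0 j (mem_index_enum _).
by rewrite mulf_eq0 gt_eqF//= sqrf_eq0 !mxE => /eqP.
Qed.

(** * Iterates of the minimal residual method *)

Lemma normT_eq0 (R : realType) (n : nat) (T : 'M[R]_n) (v : 'cV[R]_n) :
  spdmx T -> normT T v <= 0 -> v = 0.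
Proof.
move=> [_ Tpos]; apply: contraTeq => /Tpos v_gt0.
by rewrite -ltNge sqrtr_gt0.
Qed.

Lemma normT0 (R : realType) (n : nat) (T : 'M[R]_n) : normT T 0 = 0.
Proof. by rewrite /normT /dotv !mulmx0 mxE sqrtr0. Qed.

Lemma minres_iterate_exact (R : realType) (n : nat) (A T : 'M[R]_n)
    (b x0 : 'cV[R]_n) (i : nat) (x : 'cV[R]_n) :
  A \in unitmx -> spdmx T ->
  invmx A *m (b - A *m x0) \in krylov i (T *m A) (T *m (b - A *m x0)) ->
  minres_iterate A T b x0 i x <-> x = invmx A *m b.
Proof.
move=> Au Tspd; set r0 := b - A *m x0 => solK.
have r0AK : r0 \in (linfun (mulmx A : 'cV[R]_n -> 'cV[R]_n) @:
    krylov i (T *m A) (T *m r0))%VS.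
  apply/memv_imgP; exists (invmx A *m r0) => //.
  by rewrite lfunE /= mulKVmx.
have x0E : invmx A *m r0 = invmx A *m b - x0 by rewrite mulmxBr mulKmx.
(* The lower bound is tested at the value 0, attained by taking r0 itself as the correction. *)
split=> [[_ _ [_ /(_ 0) minx]]|->].
  have /(normT_eq0 Tspd)/eqP : normT T (b - A *m x) <= 0.
    apply: minx; by exists r0; last by rewrite subrr normT0.
  by rewrite subr_eq0 => /eqP ->; rewrite mulKmx.
split; [exact: Tspd | by rewrite -x0E |].
rewrite mulKVmx// subrr normT0; split; last first.
  by move=> _ [u _ <-]; apply: sqrtr_ge0.
by exists r0; last by rewrite subrr normT0.
Qed.

Theorem theorem2p1 (R : realType) (n : nat) (A T : 'M[R]_n) (b x0 : 'cV[R]_n)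
  (A_nonsingular : A \in unitmx)
  (A_indefinite : indefinitemx A)
  (T_def : T = invmx (absmx A)) :
  exists i : nat, (i <= 2)%N /\
    forall x : 'cV[R]_n, minres_iterate A T b x0 i x <-> x = invmx A *m b.
Proof.
have [A_sym _] := A_indefinite.
have [V [d [[VV AE] d0 TE]]] := invmx_absmxE A_nonsingular A_sym.
exists 2%N; split=> // x.
have Tspd : spdmx T.
  by rewrite T_def TE; apply: spdmx_diag => // j; rewrite mxE invr_gt0 normr_gt0.
apply: minres_iterate_exact => //.
(* The diagonal entries are (d_j / |d_j|)^2 = 1. *)
have TATA : T *m A *m T *m A = 1%:M.
  rewrite -mulmxA T_def TE AE !eigen_decompositionM//.
  rewrite (_ : \row_j _ = const_mx 1).
    by rewrite diag_const_mx mulmx1 (mulmx1C VV).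
  apply/rowP => j; rewrite !mxE mulrACA -invfM -!expr2.
  by rewrite real_normK ?num_real// mulVf// sqrf_eq0.
have -> : invmx A = T *m A *m T.
  by rewrite -[LHS]mul1mx -TATA mulmxK.
(* The initial error is the generator with exponent 1, the last one in the list for i = 2. *)
apply: memv_span; rewrite /= expr1 !inE !mulmxA.
by rewrite eqxx orbT.
Qed.
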